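(* Let $X$ be a non-empty set. For all $x,u,v,w\in X$ the following equalities of equivalence classes of trees in $\mathcal T(X)$ hold: $$\Delta^x_\varepsilon\big(u,\Sigma^x_\varepsilon(\Sigma^x_\varepsilon(u,v),w)\big)=\Sigma_\varepsilon^{\circ(x,u)}(v,w),$$ $$\Sigma^x_\varepsilon\big(u,\Sigma_\varepsilon^{\circ(x,u)}(v,w)\big)=\Sigma^x_\varepsilon\big(\Sigma^x_\varepsilon(u,v),w\big).$$
   Context: **Trees.** Consider planar binary trees with leaves in $X$ and each node decorated with one of two colours $\circ,\bullet$. For trees $P,Q$ write $\circ(P,Q)$ (resp. $\bullet(P,Q)$) for the tree whose root is a node coloured $\circ$ (resp. $\bullet$) with left subtree $P$ and right subtree $Q$; each $x\in X$ is identified with the tree having no nodes and single leaf $x$. ($\circ(x,u)$ codes the dilatation $\delta^x_\varepsilon u$, and $\bullet$ codes dilatation of coefficient $\varepsilon^{-1}$.) $\mathcal T(X)$ is the smallest class of such trees, containing $X$ (and the empty tree), with an equivalence relation $\approx$, such that: - T0: for $x,u,v\in X$ the trees $\circ(x,u)$, $\bullet(\circ(x,u),\circ(x,v))$, $\bullet(\circ(x,u),x)$, $\bullet(x,\circ(\circ(x,u),v))$ belong to $\mathcal T(X)$, and $\mathcal T(X)$ is closed under grafting (replacing a leaf of a tree by a tree); - T1: at any place inside a tree, a subtree $\bullet(Z,\circ(Z,Q))$ or $\circ(Z,\bullet(Z,Q))$ ($Z,Q$ trees) may be replaced by $Q$, and conversely, giving an equivalent tree; if the reduced tree is in $\mathcal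 T(X)$, so is the unreduced one; - T2: for $x\in X$, a subtree $\circ(x,x)$ or $\bullet(x,x)$ may be replaced by the leaf $x$, and conversely, giving an equivalent tree; these trees belong to $\mathcal T(X)$. Two trees are equivalent if and only if one is obtained from the other by finitely many applications of T1, T2. Equality of expressions below means equality of equivalence classes. **Operations.** For trees $Z,P,Q$: $\Delta^Z_\varepsilon(P,Q)$ is the class of $\bullet(\circ(Z,P),\circ(Z,Q))$; $\Sigma^Z_\varepsilon(P,Q)$ is the class of $\bullet(Z,\circ(\circ(Z,P),Q))$. *)

(* Defs.v *)
From HB Require Import structures.
From Stdlib Require Import Relation_Operators.
From mathcomp Require Import all_boot.
From mathcomp Require Import boolp.

Set Implicit Arguments.
Unset Strict Implicit.
Unset Printing Implicit Defensive.

Local Open Scope quotient_scope.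

(* [White] codes dilatations of coefficient epsilon, [Black] those of
   coefficient epsilon^-1. *)
Inductive colour := White | Black.

Inductive btree (X : Type) :=
| Leaf of X
| Node of colour & btree X & btree X.

Notation "P '∘' Q" := (Node White P Q) (at level 40, left associativity).
Notation "P '•' Q" := (Node Black P Q) (at level 40, left associativity).

(* [None] is the empty tree, which is never a subtree of another tree. *)
Definition tree (X : Type) := option (btree X).

(* [somewhere R P P'] : P' is P with one subtree S, at one place,
   replaced by some S' such that [R S S']. *)
Inductive somewhere (X : Type) (R : btree X -> btree X -> Prop) :
    btree X -> btree X -> Prop :=
| somewhere_root P P' : R P P' -> somewhere R P P'
| somewhere_left c P P' Q :
    somewhere R P P' -> somewhere R (Node c P Q) (Node c P' Q)
| somewhere_right c P Q Q' :
    somewhere R Q Q' -> somewhere R (Node c P Q) (Node c P Q').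

Definition replace_leaf (X : Type) (Q : btree X) : btree X -> btree X -> Prop :=
  fun L P => (exists x, L = Leaf x) /\ P = Q.

(* [graft P Q P'] : P' is P with one occurrence of a leaf replaced by Q. *)
Definition graft (X : Type) (P Q P' : btree X) : Prop :=
  somewhere (replace_leaf Q) P P'.

Inductive T1_rule (X : Type) : btree X -> btree X -> Prop :=
| T1_black Z Q : T1_rule (Z • (Z ∘ Q)) Q
| T1_white Z Q : T1_rule (Z ∘ (Z • Q)) Q.

Inductive T2_rule (X : Type) : btree X -> btree X -> Prop :=
| T2_white x : T2_rule (Leaf x ∘ Leaf x) (Leaf x)
| T2_black x : T2_rule (Leaf x • Leaf x) (Leaf x).

Inductive in_T (X : Type) : tree X -> Prop :=
| in_T_empty : in_T None
| in_T_leaf x : in_T (Some (Leaf x))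
| in_T0_dil x u : in_T (Some (Leaf x ∘ Leaf u))
| in_T0_diff x u v :
    in_T (Some ((Leaf x ∘ Leaf u) • (Leaf x ∘ Leaf v)))
| in_T0_inv x u : in_T (Some ((Leaf x ∘ Leaf u) • Leaf x))
| in_T0_sum x u v :
    in_T (Some (Leaf x • ((Leaf x ∘ Leaf u) ∘ Leaf v)))
| in_T0_graft P Q P' :
    in_T (Some P) -> in_T (Some Q) -> graft P Q P' -> in_T (Some P')
| in_T1 P P' : somewhere (@T1_rule X) P P' -> in_T (Some P') -> in_T (Some P)
| in_T2 P x : T2_rule P (Leaf x) -> in_T (Some P).

Definition treeT (X : Type) := {P : tree X | in_T P}.

HB.instance Definition _ (X : Type) := gen_eqMixin (treeT X).
HB.instance Definition _ (X : Type) := gen_choiceMixin (treeT X).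

Definition reduces (X : Type) (P P' : treeT X) : Prop :=
  exists p p', [/\ sval P = Some p, sval P' = Some p' &
    somewhere (@T1_rule X) p p' \/ somewhere (@T2_rule X) p p'].

(* All the intermediate trees of a chain of moves are required to be in T(X). *)
Definition approx (X : Type) : treeT X -> treeT X -> Prop :=
  clos_refl_sym_trans (treeT X) (@reduces X).

Definition approxb (X : Type) : rel (treeT X) := fun P Q => `[< approx P Q >].

Lemma approxb_refl (X : Type) : reflexive (@approxb X).
Proof. by move=> P; apply/asboolP; apply: rst_refl. Qed.

Lemma approxb_sym (X : Type) : symmetric (@approxb X).
Proof.
by move=> P Q; apply/asboolP/asboolP => h; apply: rst_sym.
Qed.

Lemma approxb_trans (X : Type) : transitive (@approxb X).
Proof.
move=> Q P R /asboolP hPQ /asboolP hQR; apply/asboolP.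
exact: rst_trans hPQ hQR.
Qed.

Canonical approx_equiv (X : Type) : equiv_rel (treeT X) :=
  EquivRel (@approxb X) (@approxb_refl X) (@approxb_sym X) (@approxb_trans X).

Definition classT (X : Type) := {eq_quot (approx_equiv X)}.

HB.instance Definition _ (X : Type) := Choice.on (classT X).
HB.instance Definition _ (X : Type) := EqQuotient.on (classT X).

Definition cls (X : Type) (P : treeT X) : classT X := \pi_(classT X) P.

Lemma clsP (X : Type) (P Q : treeT X) : cls P = cls Q <-> approx P Q.
Proof.
split=> [/eqmodP /asboolP //| h].
by apply/eqmodP/asboolP.
Qed.

(* A node has two nonempty subtrees; the value [None] when one of the
   arguments is empty is only a convention making the operation total. *)
Definition node_tree (X : Type) (c : colour) (P Q : tree X) : tree X :=
  match P, Q with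
  | Some p, Some q => Some (Node c p q)
  | _, _ => None
  end.

Lemma in_T_node (X : Type) (c : colour) (P Q : tree X) :
  in_T P -> in_T Q -> in_T (node_tree c P Q).
Proof.
case: P Q => [p|] [q|] /= hp hq; try exact: in_T_empty.
have [x _] : exists x : X, True.
  by elim: p {hp} => [x|_ p1 [x _] _ _]; exists x.
have h0 : in_T (Some (Node c (Leaf x) (Leaf x))).
  by case: c; [exact: in_T0_dil | apply: (@in_T2 _ _ x); constructor].
have h1 : in_T (Some (Node c p (Leaf x))).
  apply: (in_T0_graft h0 hp); apply: somewhere_left; apply: somewhere_root.
  by split=> //; exists x.
apply: (in_T0_graft h1 hq); apply: somewhere_right; apply: somewhere_root.
by split=> //; exists x.
Qed.

Definition leaf (X : Type) (x : X) : treeT X :=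
  exist _ (Some (Leaf x)) (in_T_leaf x).

Definition node (X : Type) (c : colour) (P Q : treeT X) : treeT X :=
  exist _ (node_tree c (sval P) (sval Q)) (in_T_node c (svalP P) (svalP Q)).

Definition circ (X : Type) (P Q : treeT X) : treeT X := node White P Q.
Definition bullet (X : Type) (P Q : treeT X) : treeT X := node Black P Q.

Definition Delta_tree (X : Type) (Z P Q : treeT X) : treeT X :=
  bullet (circ Z P) (circ Z Q).

Definition Sigma_tree (X : Type) (Z P Q : treeT X) : treeT X :=
  bullet Z (circ (circ Z P) Q).

(* The operations on classes; [DeltaE] and [SigmaE] say that they do not
   depend on the representatives. *)
Definition Delta (X : Type) (Z P Q : classT X) : classT X :=
  cls (Delta_tree (repr Z) (repr P) (repr Q)).

Definition Sigma (X : Type) (Z P Q : classT X) : classT X :=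
  cls (Sigma_tree (repr Z) (repr P) (repr Q)).

Lemma approx_node (X : Type) (c : colour) (P P' Q Q' : treeT X) :
  approx P P' -> approx Q Q' -> approx (node c P Q) (node c P' Q').
Proof.
move=> hP hQ; apply: (@rst_trans _ _ _ (node c P' Q)).
  elim: hP => [A B [a [b [ha hb hab]]]|A|A B _ h|A B C _ h1 _ h2].
  - case hq: (sval Q) => [q|].
      apply: rst_step; exists (Node c a q), (Node c b q).
      rewrite /= ha hb hq; split=> //.
      by case: hab => h; [left|right]; apply: somewhere_left.
    suff -> : node c A Q = node c B Q by apply: rst_refl.
    by apply: eq_exist; rewrite ha hb hq.
  - exact: rst_refl.
  - exact: rst_sym.
  - exact: rst_trans h1 h2.
elim: hQ => [A B [a [b [ha hb hab]]]|A|A B _ h|A B C _ h1 _ h2].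
- case hp: (sval P') => [p|].
    apply: rst_step; exists (Node c p a), (Node c p b).
    rewrite /= ha hb hp; split=> //.
    by case: hab => h; [left|right]; apply: somewhere_right.
  suff -> : node c P' A = node c P' B by apply: rst_refl.
  by apply: eq_exist; rewrite ha hb hp.
- exact: rst_refl.
- exact: rst_sym.
- exact: rst_trans h1 h2.
Qed.

Lemma approx_repr (X : Type) (P : treeT X) : approx (repr (cls P)) P.
Proof. by apply/clsP; rewrite /cls reprK. Qed.

Lemma DeltaE (X : Type) (Z P Q : treeT X) :
  Delta (cls Z) (cls P) (cls Q) = cls (Delta_tree Z P Q).
Proof.
apply/clsP; apply: approx_node; apply: approx_node; exact: approx_repr.
Qed.

Lemma SigmaE (X : Type) (Z P Q : treeT X) :
  Sigma (cls Z) (cls P) (cls Q) = cls (Sigma_tree Z P Q).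
Proof.
apply/clsP; apply: approx_node; first exact: approx_repr.
by apply: approx_node; [apply: approx_node|]; exact: approx_repr.
Qed.

(* Main.v *)
Require Import Defs.
From Stdlib Require Import Relation_Operators.
From mathcomp Require Import all_boot.
From mathcomp Require Import boolp.

(** Move T1 says that circ Z and bullet Z are mutually inverse. Write
    a = circ x u. Cancelling circ x against bullet x,
    Sigma^x(Sigma^x(u, v), w) = bullet x (circ (circ a v) w). Applying bullet a
    after circ x to this removes bullet x and leaves Sigma^a(v, w); conversely,
    in Sigma^x(u, Sigma^a(v, w)) the outer circ a cancels bullet a. *)

(* Nonemptiness of Z matters: a node with an empty subtree is None by
   convention. *)
Lemma circ_bulletK (X : Type) (Z Q : treeT X) :
  sval Z <> None -> approx (circ Z (bullet Z Q)) Q.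
Proof.
case: Z Q => [[z|] hz] [[q|] hq] //= _.
  apply: rst_step; exists (z ∘ (z • q)), q; split=> //.
  by left; apply: somewhere_root; constructor.
(* If [Q] is empty, both sides are the empty tree and differ only in the proof of membership. *)
by rewrite (_ : circ _ _ = exist _ None hq); [exact: rst_refl | exact: eq_exist].
Qed.

(** The inner sum has root [bullet Z], and the outer sum puts [circ Z] directly on it. *)
Lemma Sigma_tree_assoc (X : Type) (Z P Q R : treeT X) : sval Z <> None ->
  approx (Sigma_tree Z (Sigma_tree Z P Q) R)
         (bullet Z (circ (circ (circ Z P) Q) R)).
Proof.
move=> hZ; apply: approx_node; first exact: rst_refl.
by apply: approx_node; [exact: circ_bulletK | exact: rst_refl].
Qed.

Theorem proposition5 (X : Type) (hX : inhabited X) (x u v w : X) :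
  Delta (cls (leaf x)) (cls (leaf u))
    (Sigma (cls (leaf x))
      (Sigma (cls (leaf x)) (cls (leaf u)) (cls (leaf v))) (cls (leaf w)))
  = Sigma (cls (circ (leaf x) (leaf u))) (cls (leaf v)) (cls (leaf w))
  /\
  Sigma (cls (leaf x)) (cls (leaf u))
    (Sigma (cls (circ (leaf x) (leaf u))) (cls (leaf v)) (cls (leaf w)))
  = Sigma (cls (leaf x))
      (Sigma (cls (leaf x)) (cls (leaf u)) (cls (leaf v))) (cls (leaf w)).
Proof.
set a := circ (leaf x) (leaf u).
have SS : approx
    (Sigma_tree (leaf x) (Sigma_tree (leaf x) (leaf u) (leaf v)) (leaf w))
    (bullet (leaf x) (circ (circ a (leaf v)) (leaf w))).
  exact: Sigma_tree_assoc.
rewrite !SigmaE DeltaE; split; apply/clsP.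
  (* Both roots are black with left subtree [a], so only the right subtrees are compared. *)
  apply: approx_node; first exact: rst_refl.
  apply: (@rst_trans _ _ _
    (circ (leaf x) (bullet (leaf x) (circ (circ a (leaf v)) (leaf w))))).
    by apply: approx_node; [exact: rst_refl | exact: SS].
  exact: circ_bulletK.
(* Both sides reduce to the right-hand tree of [SS]; on the left the cancelling pair has
   [Z := a]. *)
apply: rst_trans (rst_sym _ _ _ _ SS).
by apply: approx_node; [exact: rst_refl | exact: circ_bulletK].
Qed.
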